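(* Let $\mathcal C=\mathcal C(I,A,(\rho_i)_{i\in I},(C^a)_{a\in A})$ be a Cartan scheme such that $\mathcal R^{\mathrm{re}}(\mathcal C)$ is a finite root system of type $\mathcal C$, let $a\in A$, and fix a scalar product on $\mathbb R^I$. Then the Coxeter complex $\Delta^a_{\mathcal C}$ of $\mathcal C$ at $a$ is isomorphic to the complex $\mathcal K^a_{\mathcal C}$.
   Context: Cartan schemes. Let $I,A$ be finite sets, $A\neq\emptyset$, and $(\alpha_i)_{i\in I}$ the standard basis of $\mathbb Z^I$. A Cartan scheme $\mathcal C=\mathcal C(I,A,(\rho_i)_{i\in I},(C^a)_{a\in A})$ consists of maps $\rho_i:A\to A$ ($i\in I$) and (integer) generalized Cartan matrices $C^a=(c^a_{jk})_{j,k\in I}$ ($a\in A$) such that $\rho_i^2=\mathrm{id}$ and $c^a_{ij}=c^{\rho_i(a)}_{ij}$ for all $a\in A$, $i,j\in I$. Define $\sigma_i^a\in\operatorname{Aut}(\mathbb Z^I)$ by $\sigma_i^a(\alpha_j)=\alpha_j-c^a_{ij}\alpha_i$ for all $j\in I$. Weyl groupoid. $\mathcal W(\mathcal C)$ is the category (a groupoid) with object set $A$ whose morphisms are the compositions of the maps $\sigma_i^a$, each regarded as an element of $\operatorname{Hom}(a,\rho_i(a))$ (morphisms with the same source and target are equal iff they are equal as linear maps). Upper indices are omitted when determined by context; $\mathrm{id}^a\sigma_{i_1}\cdots\sigma_{i_k}$ denotes the composition with target $a$. $\operatorname{Hom}(\mathcal W(\mathcal C),a)$ is the disjoint union $\bigcup_{b\in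 A}\operatorname{Hom}(b,a)$. Roots. $(R^{\mathrm{re}})^a=\{\mathrm{id}^a\sigma_{i_1}\cdots\sigma_{i_k}(\alpha_j)\mid k\ge 0,\ i_1,\dots,i_k,j\in I\}$, and $\mathcal R^{\mathrm{re}}(\mathcal C)=(\mathcal C,((R^{\mathrm{re}})^a)_{a\in A})$. A family $(R^a)_{a\in A}$ of subsets of $\mathbb Z^I$ is a root system of type $\mathcal C$ if, with $R^a_+=R^a\cap\mathbb N_0^I$ and $m^a_{i,j}=|R^a\cap(\mathbb N_0\alpha_i+\mathbb N_0\alpha_j)|$: (R1) $R^a=R^a_+\cup -R^a_+$; (R2) $R^a\cap\mathbb Z\alpha_i=\{\alpha_i,-\alpha_i\}$; (R3) $\sigma_i^a(R^a)=R^{\rho_i(a)}$; (R4) if $i\ne j$ and $m^a_{i,j}$ is finite then $(\rho_i\rho_j)^{m^a_{i,j}}(a)=a$; for all $a\in A$, $i,j\in I$. It is finite if every $R^a$ is finite. Parabolics and cosets. For $J\subseteq I$, $\mathcal W_J(\mathcal C)$ is the smallest subgroupoid of $\mathcal W(\mathcal C)$ containing all objects and all $\sigma_j^b$ with $j\in J$, $b\in A$. For $w\in\operatorname{Hom}(b,a)$ the left coset is $w\mathcal W_J(\mathcal C)=\{wx\mid x\in\mathcal W_J(\mathcal C)\text{ with target } b\}\subseteq\operatorname{Hom}(\mathcal W(\mathcal C),a)$. Coxeter complex. Let $\Omega^a_{\mathcal C}=\{w\mathcal W_J(\mathcal C)\mid w\in\operatorname{Hom}(\mathcal W(\mathcal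 C),a),\ J\subseteq I,\ |J|=|I|-1\}$. $\Delta^a_{\mathcal C}$ is the simplicial complex (without empty face) whose faces are the non-empty subsets $F\subseteq\Omega^a_{\mathcal C}$ with $\bigcap_{w\mathcal W_J(\mathcal C)\in F}w\mathcal W_J(\mathcal C)\neq\emptyset$. The complex $\mathcal K^a_{\mathcal C}$. For $J\subseteq I$ and $w\in\operatorname{Hom}(\mathcal W(\mathcal C),a)$ let $F^w_J=\{\lambda\in\mathbb R^I\mid(\lambda,w(\alpha_j))=0\ \forall j\in J,\ (\lambda,w(\alpha_i))>0\ \forall i\in I\setminus J\}$, where $(\cdot,\cdot)$ is the fixed scalar product. $\mathcal K^a_{\mathcal C}$ is the regular CW-complex whose cells are the intersections $F^w_J\cap S^{|I|-1}$ with the unit sphere of $\mathbb R^I$, for $w\in\operatorname{Hom}(\mathcal W(\mathcal C),a)$ and $J\subsetneq I$; it is a regular CW-decomposition of $S^{|I|-1}$. Isomorphism of these (regular CW) complexes means a bijection between their faces (cells) which preserves and reflects inclusion of closures of faces; on the simplicial side this is inclusion of faces. *)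

(* Defs.v *)
From HB Require Import structures.
From mathcomp Require Import all_boot all_order all_algebra.
From mathcomp Require Import sesquilinear.
From mathcomp Require Import boolp classical_sets functions cardinality reals topology normedtype.

Set Implicit Arguments.
Unset Strict Implicit.
Unset Printing Implicit Defensive.

Import Order.TTheory GRing.Theory Num.Theory.
Import numFieldNormedType.Exports.
Local Open Scope classical_set_scope.
Local Open Scope ring_scope.

(** Conventions: Z^I and R^I are spaces of column vectors, the coordinate
    [i : I] being stored at [enum_rank i : 'I_#|I|].  An endomorphism of Z^I is
    its matrix in the standard basis, so that composition is [*m]. *)

Definition generalized_cartan_matrix (I : Type) (c : I -> I -> int) : Prop :=
  [/\ forall i, c i i = 2,
      forall i j, i <> j -> c i j <= 0
    & forall i j, c i j = 0 -> c j i = 0].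

Record cartan_scheme (I A : finType) := CartanScheme {
  rho : I -> A -> A;
  cartan : A -> I -> I -> int;
  rhoK : forall i a, rho i (rho i a) = a;
  cartanP : forall a, generalized_cartan_matrix (cartan a);
  cartan_rho : forall a i j, cartan a i j = cartan (rho i a) i j
}.

Definition alpha (I : finType) (i : I) : 'cV[int]_#|I| :=
  delta_mx (enum_rank i) 0.

Definition embed (R : realType) (I : finType) (x : 'cV[int]_#|I|) : 'cV[R]_#|I| :=
  map_mx intr x.

(** A morphism of the Weyl groupoid with a given target is a pair
    (source, linear map); the source is kept because Hom(W(C), a) is a disjoint
    union over the sources. *)
Definition morphism (I A : finType) : Type := (A * 'M[int]_#|I|)%type.

Section WeylGroupoid.
Variables (I A : finType) (C : cartan_scheme I A).

Definition sigma (a : A) (i : I) : 'M[int]_#|I| :=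
  \matrix_(k, l) (alpha (enum_val l) - cartan C a i (enum_val l) *: alpha i) k 0.

Lemma sigma_alpha (a : A) (i j : I) :
  sigma a i *m alpha j = alpha j - cartan C a i j *: alpha i.
Proof.
by apply/colP => k; rewrite /alpha -colE !mxE enum_rankK.
Qed.

(** [word a [:: i_1; ..; i_k]] is id^a sigma_(i_1) .. sigma_(i_k).  The
    factor sigma_i with target [a] has source [rho i a]. *)
Fixpoint word (a : A) (s : seq I) : morphism I A :=
  if s is i :: s' then
    let b := rho C i a in ((word b s').1, sigma b i *m (word b s').2)
  else (a, 1%:M).

Definition hom_to (a : A) : set (morphism I A) := range (word a).

Definition hom (b a : A) : set 'M[int]_#|I| := [set w | hom_to a (b, w)].

Definition real_roots (a : A) : set 'cV[int]_#|I| :=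
  [set x | exists (s : seq I) (j : I), x = (word a s).2 *m alpha j].

Definition root_system (Rt : A -> set 'cV[int]_#|I|) : Prop :=
  let pos a := Rt a `&` [set x | forall k, 0 <= x k 0] in
  [/\ forall a, Rt a = pos a `|` [set - x | x in pos a],
      forall a i, Rt a `&` [set n *: alpha i | n in [set: int]] =
                  [set alpha i; - alpha i],
      forall a i, [set sigma a i *m x | x in Rt a] = Rt (rho C i a)
    & forall a i j m, i != j ->
        (Rt a `&` [set x | exists p q : nat, x = alpha i *+ p + alpha j *+ q]
           #= `I_m)%card ->
        iter m (rho C i \o rho C j) a = a].

Definition finite_root_system (Rt : A -> set 'cV[int]_#|I|) : Prop :=
  root_system Rt /\ forall a, finite_set (Rt a).

Definition subgroupoid (H : A -> A -> set 'M[int]_#|I|) : Prop :=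
  [/\ forall b a, H b a `<=` hom b a,
      forall a, H a a 1%:M,
      forall c b a x w, H c b x -> H b a w -> H c a (w *m x)
    & forall b a w, H b a w -> H a b (invmx w)].

(** Hom(b, a) in the parabolic subgroupoid W_J(C) *)
Definition parabolic (J : {set I}) (b a : A) : set 'M[int]_#|I| :=
  [set x | forall H, subgroupoid H ->
    (forall (j : I) (c : A), j \in J -> H c (rho C j c) (sigma c j)) -> H b a x].

Definition left_coset (w : morphism I A) (J : {set I}) : set (morphism I A) :=
  [set y | exists2 x, parabolic J y.1 w.1 x & y.2 = w.2 *m x].

(** [#|J|.+1 = #|I|] rather than [#|J| = #|I|.-1]: for empty [I] there is no
    such [J]. *)
Definition maximal_cosets (a : A) : set (set (morphism I A)) :=
  [set X | exists (w : morphism I A) (J : {set I}),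
    [/\ hom_to a w, #|J|.+1 = #|I| & X = left_coset w J]].

Definition coxeter_complex (a : A) : set (set (set (morphism I A))) :=
  [set F | [/\ F !=set0, F `<=` maximal_cosets a & \bigcap_(X in F) X !=set0]].

Section Cells.
Variables (R : realType) (dot : {dot 'cV[R]_#|I| for @idfun R}).

Definition root_cone (w : 'M[int]_#|I|) (J : {set I}) : set 'cV[R]_#|I| :=
  [set l | (forall j, j \in J -> dot l (embed R (w *m alpha j)) = 0) /\
           (forall i, i \notin J -> 0 < dot l (embed R (w *m alpha i)))].

Definition unit_sphere : set 'cV[R]_#|I| := [set l | dot l l = 1].

Definition cell_complex (a : A) : set (set 'cV[R]_#|I|) :=
  [set D | exists (w : morphism I A) (J : {set I}),
    [/\ hom_to a w, J \proper [set: I]%SET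
      & D = root_cone w.2 J `&` unit_sphere]].

End Cells.
End WeylGroupoid.

Definition face_isomorphic (T U : Type) (K : set T) (leK : T -> T -> Prop)
    (L : set U) (leL : U -> U -> Prop) : Prop :=
  exists2 f : T -> U, set_bij K L f &
    forall x y, K x -> K y -> leK x y <-> leL (f x) (f y).

(* Main.v *)
(** Right multiplication by [sigma_i] moves from one chamber of the arrangement of
    real roots at [a] to the neighbour across the wall of [w alpha_i]; call it a
    descent when [w alpha_i] is negative, which lowers the number of inversions
    of [w].  Two descents from the same morphism can be completed by the longest
    alternating words in [i] and [j], and these agree: their sources by (R4),
    their matrices because a nonnegative automorphism with nonnegative inverse
    fixing [alpha_i] and [alpha_j] is trivial.  By Newman's lemma every morphism
    with target [a] descends to the identity.  Following such a descent shows
    that two closed chambers containing a vector [l] differ by an element of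
    [W_J], [J] being the set of walls through [l].  So closed chambers meet
    exactly as the cosets do, and a face [{w W_(I - i) | i in K}] corresponds to
    the cell where [w alpha_i] is positive for [i] in [K] and zero elsewhere. *)
Require Import Defs.
From mathcomp Require Import all_boot all_order all_algebra.
From mathcomp Require Import zify.
From mathcomp Require Import sesquilinear.
From mathcomp Require Import boolp classical_sets functions cardinality reals topology normedtype.
From mathcomp Require Import realfun.
Import numFieldNormedType.Exports.
Import Order.TTheory GRing.Theory Num.Theory.

Local Open Scope classical_set_scope.
Local Open Scope ring_scope.

Set Implicit Arguments.
Unset Strict Implicit.

Local Notation hom := Defs.hom.

(** * Integer vectors and matrices *)

Section Vectors.
Variable I : finType.
Implicit Types (x y : 'cV[int]_#|I|) (A B : 'M[int]_#|I|) (i j k : I).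

Definition entry x k : int := x (enum_rank k) 0.

Lemma entryD x y k : entry (x + y) k = entry x k + entry y k.
Proof. by rewrite /entry mxE. Qed.
Lemma entryN x k : entry (- x) k = - entry x k.
Proof. by rewrite /entry mxE. Qed.
Lemma entryZ n x k : entry (n *: x) k = n * entry x k.
Proof. by rewrite /entry mxE. Qed.
Lemma entry_alpha i k : entry (alpha i) k = (k == i)%:R.
Proof. by rewrite /entry mxE eqxx andbT (inj_eq enum_rank_inj). Qed.

Lemma entryP x y : entry x =1 entry y -> x = y.
Proof. by move=> h; apply/colP => k; have := h (enum_val k); rewrite /entry enum_valK. Qed.

Lemma vec_expand x : x = \sum_i entry x i *: alpha i.
Proof.
apply/entryP => k; rewrite {2}/entry summxE (bigD1 k) //= -/(entry _ k) entryZ.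
rewrite entry_alpha eqxx mulr1 big1 ?addr0 // => i ik.
by rewrite -/(entry _ k) entryZ entry_alpha eq_sym (negPf ik) mulr0.
Qed.

Lemma mulmx_expand A x : A *m x = \sum_i entry x i *: (A *m alpha i).
Proof.
rewrite {1}[x]vec_expand mulmx_sumr; apply: eq_bigr => i _.
by rewrite scalemxAr.
Qed.

Lemma entry_mul A x k : entry (A *m x) k = \sum_i entry x i * entry (A *m alpha i) k.
Proof.
rewrite mulmx_expand {1}/entry summxE; apply: eq_bigr => i _.
by rewrite -/(entry _ k) entryZ.
Qed.

Lemma mx_alphaP A B : (forall j, A *m alpha j = B *m alpha j) -> A = B.
Proof.
move=> h; apply/matrixP => k l.
have := h (enum_val l); rewrite /alpha enum_valK -!colE => /colP/(_ k).
by rewrite !mxE.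
Qed.

Lemma alpha_neq0 i : alpha i != 0.
Proof.
by apply/eqP => /(congr1 (entry^~ i)); rewrite entry_alpha eqxx /entry mxE.
Qed.

Lemma alpha_inj : injective (@alpha I).
Proof.
move=> i j /(congr1 (entry^~ i)); rewrite !entry_alpha eqxx.
by case: eqP.
Qed.

Definition nonneg x : bool := [forall k, 0 <= entry x k].
Definition nonpos x : bool := nonneg (- x).

Lemma nonnegP x : reflect (forall k, 0 <= entry x k) (nonneg x).
Proof. exact: forallP. Qed.

Lemma nonposP x : reflect (forall k, entry x k <= 0) (nonpos x).
Proof.
by apply: (iffP (nonnegP _)) => h k; move: (h k); rewrite entryN oppr_ge0.
Qed.

Lemma nonneg_nonpos x : nonneg x -> nonpos x -> x = 0.
Proof.
move=> /nonnegP p /nonposP n; apply/entryP => k; rewrite {2}/entry mxE.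
by apply/eqP; rewrite eq_le n p.
Qed.

Lemma nonpos_opp x : nonpos (- x) = nonneg x.
Proof. by rewrite /nonpos opprK. Qed.

Lemma nonneg_alpha i : nonneg (alpha i).
Proof. by apply/nonnegP => k; rewrite entry_alpha. Qed.

(** The disjunction exempts the columns of [A] that [x] does not use, whose signs are unknown when
    [A] is controlled only on a subset of the simple roots. *)
Lemma nonneg_mul A x : (forall i, entry x i = 0 \/ nonneg (A *m alpha i)) ->
  nonneg x -> nonneg (A *m x).
Proof.
move=> hA /nonnegP hx; apply/nonnegP => k; rewrite entry_mul.
apply: sumr_ge0 => i _; case: (hA i) => [->|/nonnegP ?]; first by rewrite mul0r.
exact: mulr_ge0.
Qed.

Lemma nonpos_mul A x : (forall i, entry x i = 0 \/ nonpos (A *m alpha i)) ->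
  nonneg x -> nonpos (A *m x).
Proof.
move=> hA hx; rewrite /nonpos -mulNmx; apply: nonneg_mul => // i.
by rewrite mulNmx; exact: hA.
Qed.

(** [A - 1] has image in the span of the [alpha j] with [j \in J]. *)
Definition id_off (J : {pred I}) A : Prop :=
  forall k, k \notin J -> forall x, entry (A *m x) k = entry x k.

Lemma id_off1 J : id_off J 1%:M.
Proof. by move=> k _ x; rewrite mul1mx. Qed.

Lemma id_offM J A B : id_off J A -> id_off J B -> id_off J (A *m B).
Proof. by move=> hA hB k kJ x; rewrite -mulmxA hA // hB. Qed.

Lemma id_offV J A : A \in unitmx -> id_off J A -> id_off J (invmx A).
Proof. by move=> uA hA k kJ x; rewrite -(hA _ kJ) mulKVmx. Qed.

Definition supported (J : {pred I}) x : bool := [forall k, (k \in J) || (entry x k == 0)].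

Lemma supportedP (J : {pred I}) x :
  reflect (forall k, k \notin J -> entry x k = 0) (supported J x).
Proof.
apply: (iffP forallP) => h k; last by case: (boolP (k \in J)) => //= /h ->.
by move=> /negPf kJ; have := h k; rewrite kJ => /eqP.
Qed.

Lemma supported_mul (J : {pred I}) A x : id_off J A -> supported J (A *m x) = supported J x.
Proof.
by move=> h; apply/supportedP/supportedP => hx k kJ; have := hx k kJ; rewrite h.
Qed.

Lemma supported_alpha (J : {pred I}) i : supported J (alpha i) = (i \in J).
Proof.
apply/supportedP/idP => [h|iJ k].
  by apply/negPn/negP => /h; rewrite entry_alpha eqxx.
by rewrite entry_alpha; case: eqP => // ->; rewrite iJ.
Qed.

End Vectors.

(** * The Weyl groupoid and its real roots *)

Section Groupoid.
Variables (I A : finType) (C : cartan_scheme I A).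
Implicit Types (a b c : A) (i j : I) (s t : seq I) (w v : 'M[int]_#|I|).

Lemma sigma_rho b i : sigma C (rho C i b) i = sigma C b i.
Proof. by apply/mx_alphaP => j; rewrite !sigma_alpha -cartan_rho. Qed.

Lemma cartan_diag b i : cartan C b i i = 2.
Proof. by have [] := cartanP C b. Qed.

Lemma sigma_alpha_id b i : sigma C b i *m alpha i = - alpha i.
Proof. by rewrite sigma_alpha cartan_diag scaler_nat mulr2n opprD addNKr. Qed.

Lemma sigmaK b i : sigma C b i *m sigma C b i = 1%:M.
Proof.
apply/mx_alphaP => j; rewrite -mulmxA sigma_alpha mulmxBr -scalemxAr.
by rewrite sigma_alpha_id sigma_alpha scalerN opprK subrK mul1mx.
Qed.

Lemma sigma_off b i (J : {pred I}) : i \in J -> id_off J (sigma C b i).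
Proof.
move=> iJ k kJ x; rewrite [in RHS](vec_expand x) mulmx_expand /entry !summxE.
apply: eq_bigr => j _; rewrite -!/(entry _ k) !entryZ sigma_alpha entryD entryN entryZ.
have /negPf ki : k != i by apply: contraNneq kJ => ->.
by rewrite [entry (alpha i) k]entry_alpha ki mulr0 subr0.
Qed.

Lemma word_cat a s t : word C a (s ++ t) =
  ((word C (word C a s).1 t).1, (word C a s).2 *m (word C (word C a s).1 t).2).
Proof.
elim: s a => [|i s ih] a /=; first by rewrite mul1mx; case: word.
by rewrite ih /= mulmxA.
Qed.

Lemma word_rcons a s i : word C a (rcons s i) =
  (rho C i (word C a s).1, (word C a s).2 *m sigma C (word C a s).1 i).
Proof. by rewrite -cats1 word_cat /= mulmx1 sigma_rho. Qed.

(** The matrix of a reflection is the same at both of its ends and squares to the identity, so the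
    reversed word, read from the source, inverts the morphism. *)
Lemma word_rev a s : exists2 v, word C (word C a s).1 (rev s) = (a, v) &
  (word C a s).2 *m v = 1%:M.
Proof.
elim: s a => [|i s ih] a /=; first by exists 1%:M => //; rewrite mul1mx.
have [v ev hv] := ih (rho C i a).
exists (v *m sigma C (rho C i a) i).
  by rewrite rev_cons word_rcons ev /= rhoK.
by rewrite mulmxA -(mulmxA (sigma _ _ _)) hv mulmx1 sigmaK.
Qed.

Lemma hom_word a s : hom C (word C a s).1 a (word C a s).2.
Proof. by exists s => //; case: word. Qed.

Lemma homP b a w : hom C b a w -> exists s, word C a s = (b, w).
Proof. by case=> s _; exists s. Qed.

Lemma hom_unit b a w : hom C b a w -> w \in unitmx.
Proof.
move=> /homP [s e]; have [v _] := word_rev a s; rewrite e /= => h.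
by have [] := mulmx1_unit h.
Qed.

Lemma hom1 a : hom C a a 1%:M.
Proof. by exists [::]. Qed.

Lemma homM c b a x w : hom C c b x -> hom C b a w -> hom C c a (w *m x).
Proof.
move=> /homP [s es] /homP [t et]; exists (t ++ s) => //.
by rewrite word_cat et /= es.
Qed.

Lemma homV b a w : hom C b a w -> hom C a b (invmx w).
Proof.
move=> h; have /homP [s e] := h; have [v ev] := word_rev a s.
rewrite e /= in ev * => hv; exists (rev s) => //; rewrite ev; congr pair.
by rewrite -[LHS](mulKmx (hom_unit h)) hv mulmx1.
Qed.

Lemma hom_sigma b i : hom C (rho C i b) b (sigma C b i).
Proof. by exists [:: i] => //=; rewrite mulmx1 sigma_rho. Qed.

Lemma root_alpha a i : real_roots C a (alpha i).
Proof. by exists [::], i; rewrite mul1mx. Qed.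

Lemma root_hom b a w x : hom C b a w -> real_roots C b x -> real_roots C a (w *m x).
Proof.
move=> /homP [s e] [t [j ->]]; exists (s ++ t), j.
by rewrite word_cat e /= mulmxA.
Qed.

Lemma root_neq0 a x : real_roots C a x -> x != 0.
Proof.
move=> [s [j ->]]; apply: contra_neq (alpha_neq0 j) => h.
by rewrite -(mulKmx (hom_unit (hom_word a s)) (alpha j)) h mulmx0.
Qed.

Lemma root_not_both a x : real_roots C a x -> nonneg x -> ~~ nonpos x.
Proof.
move=> rx p; apply/negP => n; have := root_neq0 rx.
by rewrite (nonneg_nonpos p n) eqxx.
Qed.

Lemma root_opp a x : real_roots C a x -> real_roots C a (- x).
Proof.
move=> [s [j ->]]; exists (rcons s j), j.
rewrite word_rcons /= -mulmxA sigma_alpha_id.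
by rewrite mulmxN.
Qed.

Lemma word_off a s (J : {pred I}) : {subset s <= J} -> id_off J (word C a s).2.
Proof.
elim: s a => [|i s ih] a sJ /=; first exact: id_off1.
apply: id_offM; first by apply: sigma_off; apply: sJ; rewrite mem_head.
by apply: ih => k ks; apply: sJ; rewrite inE ks orbT.
Qed.

Hypothesis hC : finite_root_system C (real_roots C).

Lemma root_sign a x : real_roots C a x -> nonneg x || nonpos x.
Proof.
have [[R1 _ _ _] _] := hC; have posE (y : 'cV[int]_#|I|) :
    (forall k, 0 <= y k 0) -> nonneg y.
  by move=> h; apply/nonnegP => k; exact: h.
rewrite R1 => -[[_ /posE -> //]|[y [_ /posE h] <-]].
by rewrite nonpos_opp h orbT.
Qed.

Lemma root_nonneg a x : real_roots C a x -> nonneg x = ~~ nonpos x.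
Proof.
move=> rx; apply/idP/idP; first exact: root_not_both rx.
by case/orP: (root_sign rx) => [//|->].
Qed.

Lemma root_supported1 a x i : real_roots C a x -> nonneg x -> supported (pred1 i) x ->
  x = alpha i.
Proof.
have [[_ R2 _ _] _] := hC => rx px /supportedP sx.
have xE : x = entry x i *: alpha i.
  apply/entryP => k; rewrite entryZ entry_alpha; have [->|ki] := eqVneq k i.
    by rewrite mulr1.
  by rewrite mulr0 sx.
have : (real_roots C a `&` [set n *: alpha i | n in [set: int]]) x.
  by split=> //; exists (entry x i).
rewrite R2 => -[//|xN]; have := root_not_both rx px.
by rewrite xN nonpos_opp nonneg_alpha.
Qed.

(** The reflection changes only the coordinate [i]. If the image were negative, all other
    coordinates of [x] would vanish, and (R2) would leave only [alpha i]. *)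
Lemma sigma_nonneg b i x : real_roots C b x -> nonneg x -> x != alpha i ->
  nonneg (sigma C b i *m x).
Proof.
move=> rx px xi; have rsx : real_roots C (rho C i b) (sigma C b i *m x).
  by apply: root_hom rx; rewrite -sigma_rho -{1}(rhoK C i b); exact: hom_sigma.
rewrite (root_nonneg rsx); apply: contra xi => /nonposP n.
apply/eqP; apply: (root_supported1 rx px); apply/supportedP => k ki.
apply/eqP; rewrite eq_le (nonnegP _ px) andbT.
by have := n k; rewrite (sigma_off b (J := pred1 i)) // inE eqxx.
Qed.

Lemma root_seq a : exists2 r : seq 'cV[int]_#|I|, uniq r & forall x, x \in r <-> real_roots C a x.
Proof.
have [_ /(_ a) /finite_seqP [r e]] := hC; exists (undup r); first exact: undup_uniq.
by move=> x; rewrite mem_undup e.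
Qed.

End Groupoid.

(** * Newman's lemma *)

Section Newman.
Variables (T : Type) (step : T -> T -> Prop).

Inductive star : T -> T -> Prop :=
| star_refl x : star x x
| star_step x y z : step x y -> star y z -> star x z.

Definition normal x := forall y, ~ step x y.

Lemma star_trans x y z : star x y -> star y z -> star x z.
Proof. by elim=> // u v t st _ ih /ih; exact: star_step. Qed.

Lemma star1 x y : step x y -> star x y.
Proof. by move=> s; apply: star_step s (star_refl y). Qed.

(** The invariant [P] will be membership in [hom_to C a], and [h] the number of inverted positive
    roots at [a]. *)
Variables (P : T -> Prop) (h : T -> nat).
Hypothesis step_P : forall x y, P x -> step x y -> P y.
Hypothesis step_h : forall x y, P x -> step x y -> (h y < h x)%N.
Hypothesis confl : forall x y z, P x -> step x y -> step x z ->
  exists2 t, star y t & star z t.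

Lemma star_P x y : P x -> star x y -> P y.
Proof. by move=> Px s; elim: s Px => // u v t s _ ih /step_P /(_ s). Qed.

Lemma normal_exists x : P x -> exists2 y, star x y & normal y.
Proof.
have [n] := ubnP (h x); elim: n x => // n ih x hx Px.
have [nx|/existsNP [y /contrapT xy]] := pselect (normal x).
  by exists x => //; exact: star_refl.
have [|z yz nz] := ih y _ (step_P Px xy).
  by apply: leq_trans (step_h Px xy) _.
by exists z => //; exact: star_step xy yz.
Qed.

(** Induction on [h]: the first steps of the two reductions are joined at some [t], and the normal
    form [t'] of [t] equals both [y] and [z] by the induction hypothesis after each first step. *)
Lemma normal_unique x y z : P x -> star x y -> star x z -> normal y -> normal z -> y = z.
Proof.
have [n] := ubnP (h x); elim: n x y z => // n ih x y z hx Px sy sz ny nz.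
case: sy hx Px sz ny => [x0 _ _ sz nx|x0 y1 y0 s1 sy hx Px sz ny].
  by case: sz nx nz => // u v t s _ /(_ _ s).
case: sz s1 hx Px nz => [u s1 _ _ /(_ _ s1) //|u z1 z0 s2 sz s1 hx Px nz].
have [t t1 t2] := confl Px s1 s2.
have [t' tt' nt'] := normal_exists (star_P (step_P Px s1) t1).
have lt v : step u v -> (h v < n)%N by move=> /(step_h Px); lia.
transitivity t'.
  exact: ih (lt _ s1) (step_P Px s1) sy (star_trans t1 tt') ny nt'.
exact: ih (lt _ s2) (step_P Px s2) (star_trans t2 tt') sz nt' nz.
Qed.

End Newman.

(** * Inversions and the rank two relations *)

Section Inversions.
Variables (I A : finType) (C : cartan_scheme I A).
Hypothesis hC : finite_root_system C (real_roots C).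
Implicit Types (a b c : A) (i j : I) (s t : seq I) (w v : 'M[int]_#|I|).
Implicit Types (J : {pred I}) (r : seq 'cV[int]_#|I|).

(** For a positive root [x], this says that its wall separates the chamber of [w] from the
    fundamental chamber. *)
Definition inverted w (x : 'cV[int]_#|I|) : bool := nonpos (invmx w *m x).

(** With [y] the preimage of [x] under [w], the reflection changes the sign of [y] only if [y] is
    [alpha i] or its opposite; the opposite is excluded because [x] and [w *m alpha i] are both
    positive. *)
Lemma inverted_sigma b a w i x : hom C b a w -> nonneg (w *m alpha i) ->
    real_roots C a x -> nonneg x ->
  inverted (w *m sigma C b i) x = inverted w x || (x == w *m alpha i).
Proof.
move=> hw wi rx px; have uw := hom_unit hw; rewrite /inverted.
set y := invmx w *m x; have xE : x = w *m y by rewrite mulKVmx.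
have us : sigma C b i \in unitmx by exact: hom_unit (hom_sigma C b i).
have -> : invmx (w *m sigma C b i) *m x = sigma C b i *m y.
  have uws : w *m sigma C b i \in unitmx by rewrite unitmx_mul uw.
  rewrite -[RHS](mulKmx uws) -(mulmxA w) (mulmxA (sigma _ _ _)) sigmaK mul1mx.
  by rewrite -xE.
have ry : real_roots C b y by apply: root_hom rx; exact: homV hw.
have rsy : real_roots C (rho C i b) (sigma C b i *m y).
  by apply: root_hom ry; rewrite -sigma_rho -{1}(rhoK C i b); exact: hom_sigma.
have -> : (x == w *m alpha i) = (y == alpha i).
  by rewrite xE; apply/eqP/eqP => [/(congr1 (mulmx (invmx w)))|-> //]; rewrite !mulKmx.
have [->|yi] := eqVneq y (alpha i).
  by rewrite sigma_alpha_id nonpos_opp nonneg_alpha orbT.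
rewrite orbF; case/orP: (root_sign hC ry) => sy.
  rewrite (negPf (root_not_both ry sy)).
  by apply: negbTE; rewrite -(root_nonneg hC rsy); exact: sigma_nonneg.
rewrite sy /nonpos -mulmxN; apply: sigma_nonneg (root_opp ry) sy _ => //.
apply/eqP => yE; have := root_not_both rx px.
by rewrite /nonpos xE -mulmxN yE wi.
Qed.

(** Being duplicate-free, [r] makes [count (inverted w) r] the number of inversions of [w] inside
    the subsystem [J]: a pair of indices for the rank two relations, all of [I] for the descent. *)
Definition positive_roots J a r : Prop :=
  uniq r /\ forall x, x \in r <-> [/\ real_roots C a x, nonneg x & supported J x].

Lemma eq_positive_roots J J' a r : J =i J' -> positive_roots J a r -> positive_roots J' a r.
Proof.
move=> JJ [ur hr]; split=> // x; rewrite hr; suff -> : supported J x = supported J' x by [].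
by apply: eq_forallb => k; rewrite JJ.
Qed.

Lemma positive_roots_exists J a : exists r, positive_roots J a r.
Proof.
have [r ur hr] := root_seq hC a.
exists [seq x <- r | nonneg x && supported J x]; split; first exact: filter_uniq.
move=> x; rewrite mem_filter; split; first by case/andP=> /andP[-> ->] /hr.
by case=> /hr -> -> ->.
Qed.

(** The only new inversion is [w *m alpha i], which lies in [r] by the support condition and was not
    inverted by [w]. *)
Lemma count_inverted_sigma J a r b w i : positive_roots J a r -> hom C b a w ->
    nonneg (w *m alpha i) -> supported J (w *m alpha i) ->
  count (inverted (w *m sigma C b i)) r = (count (inverted w) r).+1.
Proof.
move=> [ur hr] hw wi si; set z := w *m alpha i.
have zr : z \in r by apply/hr; split=> //; exact: root_hom hw (root_alpha C b i).
rewrite (@eq_in_count _ _ (predU (inverted w) (pred1 z))); last first.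
  by move=> x /hr [rx px _]; rewrite (inverted_sigma hw).
have := count_predUI (inverted w) (pred1 z) r.
rewrite (@eq_count _ (predI _ _) pred0) ?count_pred0 ?addn0 => [->|x /=].
  by rewrite count_uniq_mem // zr addn1.
case: eqP => [->|]; rewrite ?andbF // andbT /inverted mulKmx ?(hom_unit hw) //.
exact: negbTE (root_not_both (root_alpha C b i) (nonneg_alpha i)).
Qed.

(** The preimage of a root of [r] is still supported in [J]. Were it positive, the root would be a
    nonnegative combination of the negative vectors [w *m alpha j], hence negative. *)
Lemma all_inverted J a r b w : positive_roots J a r -> hom C b a w -> id_off J w ->
  (forall j, j \in J -> nonpos (w *m alpha j)) -> all (inverted w) r.
Proof.
move=> [_ hr] hw ow nw; apply/allP => x /hr [rx px sx].
have uw := hom_unit hw; have ry := root_hom (homV hw) rx.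
case/orP: (root_sign hC ry) => // py.
have := root_not_both rx px; rewrite -{1}[x](mulKVmx uw).
rewrite nonpos_mul // => j; case: (boolP (j \in J)) => jJ; [right|left].
  exact: nw.
by rewrite (id_offV uw ow) //; move/supportedP: sx; apply.
Qed.

Lemma all_inverted_simple J a r w : positive_roots J a r ->
  (forall j, j \in J -> inverted w (alpha j)) -> all (inverted w) r.
Proof.
move=> [_ hr] nw; apply/allP => x /hr [rx px sx].
apply: nonpos_mul px => j; case: (boolP (j \in J)) => jJ; [right|left].
  exact: nw.
by move/supportedP: sx; apply.
Qed.

End Inversions.

(** * Longest alternating words in two letters *)

Section RankTwo.
Variables (I A : finType) (C : cartan_scheme I A).
Hypothesis hC : finite_root_system C (real_roots C).
Implicit Types (a b c : A) (i j : I) (s t : seq I) (w v : 'M[int]_#|I|).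
Implicit Types (r : seq 'cV[int]_#|I|).

Definition letter i j (k : nat) : I := if odd k then j else i.
Definition alternating i j (k : nat) : seq I := mkseq (letter i j) k.

Lemma alternating_sub i j k : {subset alternating i j k <= pred2 i j}.
Proof.
by move=> x /mapP [n _ ->]; rewrite inE /letter; case: odd; rewrite eqxx ?orbT.
Qed.

Lemma word_alternatingS b i j k : word C b (alternating i j k.+1) =
  (rho C (letter i j k) (word C b (alternating i j k)).1,
   (word C b (alternating i j k)).2 *m
     sigma C (word C b (alternating i j k)).1 (letter i j k)).
Proof. by rewrite /alternating mkseqS word_rcons. Qed.

Lemma letter_cases i j k x : x \in pred2 i j -> x = letter i j k \/ x = letter i j k.+1.
Proof. by rewrite /letter /= => /orP[] /eqP ->; case: odd; [right|left|left|right]. Qed.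

Lemma letter_pred2 i j k : letter i j k \in pred2 i j.
Proof. by rewrite inE /letter; case: odd; rewrite eqxx ?orbT. Qed.

Section Alternating.
Variables (b : A) (i j : I) (r : seq 'cV[int]_#|I|).
Hypotheses (ij : i != j) (hr : positive_roots C (pred2 i j) b r).
Let w k := (word C b (alternating i j k)).2.
Let src k := (word C b (alternating i j k)).1.
Let x k := letter i j k.

Let hom_w k : hom C (src k) b (w k). Proof. exact: hom_word. Qed.
Let off_w k : id_off (pred2 i j) (w k).
Proof. by apply: word_off; exact: alternating_sub. Qed.
Let wS k : w k.+1 = w k *m sigma C (src k) (x k).
Proof. by rewrite /w word_alternatingS. Qed.
Let w_supp k n : supported (pred2 i j) (w k *m alpha (x n)).
Proof. by rewrite supported_mul // supported_alpha letter_pred2. Qed.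

(** Each new letter adds one inversion as long as some root of [r] is not inverted. The second
    clause carries the induction: the last letter has a negative image, and [alpha i], the first
    inversion, stays inverted. *)
Lemma alternating_count k : (k <= size r)%N ->
  count (inverted (w k)) r = k /\
  ((0 < k)%N -> inverted (w k) (alpha i) /\ nonpos (w k *m alpha (x k.-1))).
Proof.
have [ur hmem] := hr.
have memi : real_roots C b (alpha i) by exact: root_alpha.
elim: k => [_|k ih km].
  split=> //; apply/eqP; rewrite -leqn0 leqNgt -has_count; apply/hasPn => y.
  move=> /hmem [ry py _]; rewrite /inverted /w /= invmx1 mul1mx.
  exact: root_not_both ry py.
have [cnt neg] := ih (ltnW km).
have pk : nonneg (w k *m alpha (x k)).
  rewrite (root_nonneg hC (root_hom (hom_w k) (root_alpha C _ _))).
  apply/negP => nk; suff : all (inverted (w k)) r.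
    by rewrite all_count cnt => /eqP e; rewrite e ltnn in km.
  (* The empty word keeps simple roots positive. After a nonempty word both letters would have
     negative images, the last one by [neg] and the next one by [nk], so all of [r] would be
     inverted too early. *)
  case: k {ih km} cnt neg nk => [|k] cnt neg nk.
    have := root_not_both (root_alpha C b (x 0)) (nonneg_alpha (x 0)).
    by rewrite -[alpha (x 0)]mul1mx nk.
  have [//|_ nk'] := neg.
  apply: (all_inverted hC hr (hom_w _) (off_w _)) => l.
  by case/(letter_cases k) => ->.
split; first by rewrite wS (count_inverted_sigma hC hr) // cnt.
move=> _; split; last by rewrite wS -mulmxA sigma_alpha_id mulmxN nonpos_opp.
rewrite wS (inverted_sigma hC (hom_w k)) ?nonneg_alpha //.
case: k {ih km pk} cnt neg => [|k] cnt neg; last by have [//|->] := neg.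
by rewrite /w /= mul1mx eqxx orbT.
Qed.

Lemma alternating_nonneg k : (k < size r)%N -> nonneg (w k *m alpha (x k)).
Proof.
move=> km; have [cnt _] := alternating_count (ltnW km).
have [_ /(_ isT) [_ /=]] := alternating_count km.
by rewrite wS -mulmxA sigma_alpha_id mulmxN nonpos_opp.
Qed.

Lemma positive_roots2_gt1 : (1 < size r)%N.
Proof.
have [ur hmem] := hr; apply: (@uniq_leq_size _ [:: alpha i; alpha j]).
  by rewrite /= inE (inj_eq (@alpha_inj I)) ij.
move=> y; rewrite !inE => /orP[] /eqP ->; apply/hmem; split;
  by rewrite ?supported_alpha ?inE ?eqxx ?orbT ?nonneg_alpha //; exact: root_alpha.
Qed.

Let m := size r.

Lemma longest_inverted : all (inverted (w m)) r.
Proof. by have [cnt _] := alternating_count (leqnn m); rewrite all_count cnt. Qed.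

(** The root [alpha j] must be the inversion gained at the last step: [w m.-1] already inverts
    [alpha i], so if it inverted [alpha j] as well it would invert all of [r], but it has only
    [m.-1] inversions. *)
Lemma longest_last : w m *m alpha (x m.-1) = - alpha j.
Proof.
have m2 := positive_roots2_gt1; have [ur hmem] := hr.
have em : m = m.-1.+1 by rewrite /m; lia.
have [cnt neg] := alternating_count (leq_pred m).
have jr : alpha j \in r.
  apply/hmem; split; rewrite ?supported_alpha ?inE ?eqxx ?orbT ?nonneg_alpha //.
  exact: root_alpha.
have := allP longest_inverted _ jr.
have pk : nonneg (w m.-1 *m alpha (x m.-1)) by apply: alternating_nonneg; rewrite -/m; lia.
rewrite {1}em wS (inverted_sigma hC (hom_w m.-1)) ?nonneg_alpha //; last exact: root_alpha.
case/orP => [nj|/eqP ->]; last by rewrite [in LHS]em wS -mulmxA sigma_alpha_id mulmxN.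
have [|ni _] := neg; first by rewrite /m; lia.
suff : all (inverted (w m.-1)) r by rewrite all_count cnt -/m => /eqP; rewrite /m; lia.
by apply: (all_inverted_simple hr) => l; rewrite !inE => /orP[] /eqP ->.
Qed.

(** On the span of [alpha i] and [alpha j] both [- w m] and its inverse are
    nonnegative, and [- w m] maps one simple root to [alpha j]. *)
Lemma longest_penultimate : w m *m alpha (x m) = - alpha i.
Proof.
have m2 := positive_roots2_gt1; have [ur hmem] := hr.
have um := hom_unit (hom_w m).
set y := w m *m alpha (x m).
have ry : real_roots C b y by exact: root_hom (hom_w m) (root_alpha _ _ _).
have ny : nonpos y.
  case/orP: (root_sign hC ry) => // py.
  have /(allP longest_inverted) : y \in r by apply/hmem; split=> //; exact: w_supp.
  rewrite /inverted mulKmx // => n.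
  by have := root_not_both (root_alpha C b (x m)) (nonneg_alpha (x m)); rewrite n.
have : alpha i \in r.
  apply/hmem; split; rewrite ?supported_alpha ?inE ?eqxx ?orbT ?nonneg_alpha //.
  exact: root_alpha.
move=> /(allP longest_inverted); rewrite /inverted; set z := invmx _ *m _ => nz.
have zi : w m *m z = alpha i by rewrite mulKVmx.
have xx : x m != x m.-1.
  have -> : x m = x m.-1.+1 by rewrite prednK // /m; lia.
  by rewrite /x /letter /=; case: odd => //=; rewrite eq_sym.
have co l : entry (w m *m z) l = entry z (x m) * entry y l + entry z (x m.-1) * entry (- alpha j) l.
  rewrite entry_mul (bigD1 (x m)) //= (bigD1 (x m.-1)) 1?eq_sym //= longest_last.
  rewrite big1 ?addr0 // => n /andP[n1 n2]; rewrite [entry z n](_ : _ = 0) ?mul0r //.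
  have nP : n \notin pred2 i j.
    have em : m = m.-1.+1 by rewrite /m; lia.
    apply/negP => /(letter_cases m.-1) []; first by apply/eqP.
    by rewrite -em; apply/eqP.
  rewrite (id_offV um (@off_w m)) // entry_alpha.
  by case: eqP nP => // ->; rewrite inE eqxx.
(* Since [w m] maps [z] to [alpha i], the coordinates [i] and [j] give two integer equations in
   nonpositive unknowns. *)
have ci := co i; have cj := co j.
rewrite zi !entryN !entry_alpha !eqxx (negPf ij) /= in ci.
rewrite zi !entryN !entry_alpha !eqxx eq_sym (negPf ij) /= in cj.
have z1 := nonposP _ nz (x m); have z2 := nonposP _ nz (x m.-1).
have y1 := nonposP _ ny i; have y2 := nonposP _ ny j.
rewrite oppr0 mulr0 addr0 in ci; rewrite mulrN1 in cj.
(* Two nonpositive integers with product 1 both equal -1. The other equation then makes a sum of two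
   nonpositive integers zero. *)
have yi : entry y i = -1.
  have: entry z (x m) * entry y i == 1 by rewrite -ci.
  by move: z1 y1; case: (entry z (x m)) => [[|?]|[|?]]; case: (entry y i) => [[|?]|[|?]].
have yj : entry y j = 0.
  have zm : entry z (x m) = -1 by rewrite yi in ci; lia.
  by rewrite zm in cj; lia.
apply: entryP => l; rewrite entryN entry_alpha; have [->|li] := eqVneq l i => //.
have [->|lj] := eqVneq l j => //.
rewrite oppr0; move/supportedP: (w_supp m m); apply.
by rewrite !inE negb_or li.
Qed.

End Alternating.

(** Modulo [P] the columns of [u] and [u^-1] are those of the identity, so both
    are nonnegative, and their parts in the span of [P] are opposite. *)
Lemma hom_fix_eq1 c u (P : {pred I}) : hom C c c u -> id_off P u ->
  (forall i, i \in P -> u *m alpha i = alpha i) -> u = 1%:M.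
Proof.
move=> hu ou fu; apply/mx_alphaP => k; rewrite mul1mx.
case: (boolP (k \in P)) => [/fu //|kP].
have uu := hom_unit hu.
have nn v : hom C c c v -> id_off P v -> nonneg (v *m alpha k).
  move=> hv ov; rewrite (root_nonneg hC (root_hom hv (root_alpha C c k))).
  by apply/negP => /nonposP /(_ k); rewrite ov // entry_alpha eqxx.
pose d := u *m alpha k - alpha k.
have dP l : l \notin P -> entry d l = 0 by move=> lP; rewrite entryD entryN ou // subrr.
(* The difference [d] lies in the span of the [alpha i] with [i] in [P], which [u] fixes
   pointwise. *)
have ud : invmx u *m d = d.
  rewrite -[X in _ *m X](_ : u *m d = d) ?mulKmx //.
  rewrite mulmx_expand [RHS]vec_expand; apply: eq_bigr => l _.
  by case: (boolP (l \in P)) => [/fu -> //|/dP ->]; rewrite !scale0r.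
have uk : u *m alpha k = alpha k + d by rewrite addrC subrK.
have vk : invmx u *m alpha k = alpha k - d.
  by apply: (canRL (addrK d)); rewrite -{1}ud -mulmxDr -uk mulKmx.
move: d dP ud uk vk => d dP ud uk vk.
have pu := nonnegP _ (nn _ hu ou); have pv := nonnegP _ (nn _ (homV hu) (id_offV uu ou)).
rewrite uk [d](_ : _ = 0) ?addr0 //; apply/entryP => l; rewrite [RHS]mxE.
case: (boolP (l \in P)) => [lP|/dP //].
have lk : (l == k) = false by apply: contraNF kP => /eqP <-.
have := pu l; have := pv l; rewrite uk vk !entryD !entryN entry_alpha lk /=.
by lia.
Qed.

Lemma card_uniq_seq (T : eqType) (r : seq T) : uniq r -> ([set` r] #= `I_(size r))%card.
Proof.
elim: r => [_|x r ih /= /andP[xr ur]]; first by rewrite II0 card_eq0 set_nil.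
apply/eq_cardSP; exists x; first by rewrite /= mem_head.
rewrite (_ : _ `\ _ = [set` r]); first exact: ih.
apply/seteqP; split=> y /=; first by rewrite inE => -[/orP[/eqP|]].
by move=> yr; rewrite inE yr orbT; split=> // yx; rewrite -yx yr in xr.
Qed.

(** Identifies [size r] with the exponent of (R4): the roots that are nonnegative combinations of
    [alpha i] and [alpha j] are the positive roots supported there. *)
Lemma card_positive_roots2 b i j r : i != j -> positive_roots C (pred2 i j) b r ->
  (real_roots C b `&` [set x | exists p q : nat, x = alpha i *+ p + alpha j *+ q]
           #= `I_(size r))%card.
Proof.
move=> ij [ur hr]; rewrite (_ : _ `&` _ = [set` r]); first exact: card_uniq_seq.
apply/seteqP; split=> x /=.
  move=> [rx [p [q xE]]]; apply/hr; split=> //.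
    by apply/nonnegP => k; rewrite xE -!scaler_nat entryD !entryZ !entry_alpha -!natrM -natrD.
  apply/supportedP => k; rewrite !inE negb_or => /andP[/negPf ki /negPf kj].
  by rewrite xE -!scaler_nat entryD !entryZ !entry_alpha ki kj !mulr0 addr0.
move=> /hr [rx /nonnegP px /supportedP sx]; split=> //.
exists `|entry x i|%N, `|entry x j|%N; apply/entryP => k.
rewrite -!scaler_nat entryD !entryZ !entry_alpha !natz !gez0_abs //.
have [->|ki] := eqVneq k i; first by rewrite (negPf ij) mulr1 mulr0 addr0.
have [->|kj] := eqVneq k j; first by rewrite mulr1 mulr0 add0r.
by rewrite !mulr0 addr0 sx // !inE negb_or ki.
Qed.

Lemma rho_rho_iter b i j n :
  iter n (rho C j \o rho C i) (iter n (rho C i \o rho C j) b) = b.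
Proof. by elim: n => // n ih; rewrite iterSr iterS /= !rhoK. Qed.

Lemma source_alternating b i j k : (word C b (alternating i j k)).1 =
  (if odd k then rho C i else id) (iter k./2 (rho C j \o rho C i) b).
Proof.
elim: k => // k ih; rewrite word_alternatingS /= ih uphalf_half /letter.
by case: odd => //=.
Qed.

(** By (R4), [rho i] after [rho j], iterated [size r] times, fixes [b]. Moving half of the factors
    to the other side turns this into equality of the two sources; for odd length one [rho i] is
    moved as well. *)
Lemma source_longest b i j r : i != j -> positive_roots C (pred2 i j) b r ->
  (word C b (alternating i j (size r))).1 = (word C b (alternating j i (size r))).1.
Proof.
move=> ij hr; have [[_ _ _ R4] _] := hC.
have := R4 b i j _ ij (card_positive_roots2 ij hr).
set m := size r; rewrite !source_alternating.
rewrite -{1}[m]odd_double_half -addnn.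
set T := rho C i \o rho C j; set T' := rho C j \o rho C i; set n := m./2.
have KT y : iter n T' (iter n T y) = y by exact: rho_rho_iter.
case: odd; rewrite ?add1n ?add0n -?addSn iterD.
  rewrite iterSr => /(congr1 (iter n T')); rewrite KT => <-.
  by rewrite /= rhoK.
by move=> /(congr1 (iter n T')); rewrite KT.
Qed.

(** Both words send the same letter to [- alpha i] and the other one to [- alpha j]. So the quotient
    of their matrices fixes both simple roots, and [hom_fix_eq1] applies because the sources
    agree. *)
Lemma longest_unique b i j r : i != j -> positive_roots C (pred2 i j) b r ->
  word C b (alternating i j (size r)) = word C b (alternating j i (size r)).
Proof.
move=> ij hr.
have eqP2 : pred2 j i =i pred2 i j by move=> k; rewrite !inE orbC.
have hr' := eq_positive_roots (fun k => esym (eqP2 k)) hr.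
have ji : j != i by rewrite eq_sym.
have es := source_longest ij hr.
have m2 := positive_roots2_gt1 ij hr.
have l1 := longest_last ij hr; have l2 := longest_penultimate ij hr.
have l1' := longest_last ji hr'; have l2' := longest_penultimate ji hr'.
move: es m2 l1 l2 l1' l2'; set m := size r => es m2 l1 l2 l1' l2'.
have hA := hom_word C b (alternating i j m); have hB := hom_word C b (alternating j i m).
have oA : id_off (pred2 i j) (word C b (alternating i j m)).2.
  by apply: word_off; exact: alternating_sub.
have oB : id_off (pred2 i j) (word C b (alternating j i m)).2.
  by apply: word_off => k; rewrite -eqP2; exact: alternating_sub.
move: es hA hB oA oB l1 l2 l1' l2'.
case: (word C b (alternating i j m)) => c u; case: (word C b (alternating j i m)) => c' v /= <-.
move=> hA hB oA oB l1 l2 l1' l2'; congr pair.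
have uA := hom_unit hA.
have em : m = m.-1.+1 by lia.
suff h : invmx u *m v = 1%:M by rewrite -[RHS](mulKVmx uA) h mulmx1.
apply: (@hom_fix_eq1 c _ (pred2 i j)).
- exact: homM hB (homV hA).
- by apply: id_offM => //; exact: id_offV.
move=> k kP; rewrite -mulmxA -[RHS](mulKmx uA); congr (_ *m _).
(* Exchanging [i] and [j] shifts the alternating sequence by one place. *)
have lm : letter j i m.-1 = letter i j m by rewrite em /letter /=; case: odd.
have lm' : letter j i m = letter i j m.-1 by rewrite em /letter /=; case: odd.
rewrite lm in l1'; rewrite lm' in l2'.
by case: (letter_cases m.-1 kP) => ->; rewrite -?em ?l1 ?l2 ?l1' ?l2'.
Qed.

End RankTwo.

(** * Descent to the identity *)

Section Descent.
Variables (I A : finType) (C : cartan_scheme I A).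
Hypothesis hC : finite_root_system C (real_roots C).
Implicit Types (a b c : A) (i j : I) (w v : 'M[int]_#|I|) (x y z : morphism I A).

Definition descent x y : Prop := exists2 i, nonpos (x.2 *m alpha i) &
  y = (rho C i x.1, x.2 *m sigma C x.1 i).

Lemma hom_toE a x : hom_to C a x <-> hom C x.1 a x.2.
Proof. by case: x. Qed.

Lemma descent_hom a x y : hom_to C a x -> descent x y -> hom_to C a y.
Proof. by rewrite !hom_toE => hx [i _ ->] /=; apply: homM hx; exact: hom_sigma. Qed.

(** Read backwards, the step goes from [y] to [x] along a simple root with positive image, which
    adds one inversion. *)
Lemma descent_count J a r x y : positive_roots C J a r -> hom_to C a x -> descent x y ->
  (forall i, i \in J) -> (count (inverted y.2) r < count (inverted x.2) r)%N.
Proof.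
move=> hr hx xy hJ; have hy := descent_hom hx xy.
case: xy hy => i ni -> hy; move: hy hx; rewrite !hom_toE /= => hy hx.
have e : x.2 = x.2 *m sigma C x.1 i *m sigma C (rho C i x.1) i.
  by rewrite sigma_rho -mulmxA sigmaK mulmx1.
have pi : nonneg (x.2 *m sigma C x.1 i *m alpha i).
  by rewrite -mulmxA sigma_alpha_id mulmxN.
move: e pi hy; set w := x.2 *m sigma C x.1 i => e pi hy.
have := count_inverted_sigma hC hr hy pi; rewrite -e => -> //.
by apply/supportedP => k; rewrite hJ.
Qed.

(** While the alternating word [v] is shorter than [size r], its next letter has nonnegative image
    under [v], supported on [i] and [j]. Since [w] makes both simple roots negative, every further
    letter is a descent. *)
Lemma star_longest a b w i j r : hom C b a w -> i != j ->
    positive_roots C (pred2 i j) b r ->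
    nonpos (w *m alpha i) -> nonpos (w *m alpha j) ->
  let v := word C b (alternating i j (size r)) in
  star descent (rho C i b, w *m sigma C b i) (v.1, w *m v.2).
Proof.
move=> hw ij hr ni nj /=.
have m2 := positive_roots2_gt1 ij hr.
rewrite -(prednK (ltnW m2)).
have : ((size r).-1 < size r)%N by rewrite prednK // ltnW.
elim: (size r).-1 => [|k ih] k1.
  by rewrite word_alternatingS /= mul1mx; exact: star_refl.
apply: star_trans (ih (ltnW k1)) (star1 _).
have := alternating_nonneg hC hr k1.
have := word_off C b (@alternating_sub _ i j k.+1).
rewrite (word_alternatingS _ _ _ _ k.+1); set v := word C b (alternating i j k.+1).
move=> ov nv; exists (letter i j k.+1) => /=; last by rewrite mulmxA.
rewrite -mulmxA; apply: nonpos_mul nv => l.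
have [|lP] := boolP (l \in pred2 i j).
  by rewrite inE => /orP[] /eqP ->; right.
left; rewrite ov // entry_alpha.
by case: eqP lP => // ->; rewrite letter_pred2.
Qed.

Lemma descent_confluent a x y z : hom_to C a x -> descent x y -> descent x z ->
  exists2 t, star descent y t & star descent z t.
Proof.
case: x => b w hw [i /= ni ->] [j /= nj ->].
have [<-|ij] := eqVneq i j.
  by exists (rho C i b, w *m sigma C b i); exact: star_refl.
have [r hr] := positive_roots_exists hC (pred2 i j) b.
exists ((word C b (alternating i j (size r))).1, w *m (word C b (alternating i j (size r))).2).
  exact: star_longest hw ij hr ni nj.
rewrite (longest_unique hC ij hr); apply: star_longest hw _ _ nj ni.
  by rewrite eq_sym.
by apply: eq_positive_roots hr => k; rewrite !inE orbC.
Qed.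

(** The identity is normal because simple roots are positive. Appending a letter to a word gives a
    descent in one direction or the other: if the longer word descends to the shorter one, induction
    finishes; if the shorter descends to the longer, both have the same normal form. *)
Lemma descent_to_id a x : hom_to C a x -> star descent x (a, 1%:M).
Proof.
have [r hr] := positive_roots_exists hC predT a.
pose h x := count (inverted x.2) r.
have dP := @descent_hom a.
have dh y z : hom_to C a y -> descent y z -> (h z < h y)%N.
  by move=> hu uv; exact: descent_count hr hu uv _.
have n1 : normal descent (a, 1%:M).
  move=> y [i /= ni _]; rewrite mul1mx in ni.
  by have := root_not_both (root_alpha C a i) (nonneg_alpha i); rewrite ni.
move=> [s _ <-]; elim/last_ind: s => [|s i ih]; first exact: star_refl.
have hx : hom_to C a (word C a s) by exists s.
have hy : hom_to C a (word C a (rcons s i)) by exists (rcons s i).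
rewrite word_rcons in hy *; set z := word C a s in ih hx hy *.
have rx : real_roots C a (z.2 *m alpha i).
  by apply: root_hom (root_alpha C z.1 i); exact: (hom_toE a z).1.
case/orP: (root_sign hC rx) => [px|nx].
  apply: star_step ih; exists i => /=.
    by rewrite -mulmxA sigma_alpha_id mulmxN nonpos_opp.
  by rewrite rhoK sigma_rho -mulmxA sigmaK mulmx1; case: (z).
have xy : descent z (rho C i z.1, z.2 *m sigma C z.1 i) by exists i.
have [n yn nn] := normal_exists dP dh hy.
suff <- : n = (a, 1%:M) by [].
exact: (normal_unique dP dh (@descent_confluent a) hx (star_step xy yn) ih nn n1).
Qed.

End Descent.

(** * Cosets of parabolic subgroupoids *)

Section Parabolics.
Variables (I A : finType) (C : cartan_scheme I A).
Implicit Types (a b c : A) (i j : I) (J : {set I}) (w v : 'M[int]_#|I|).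
Implicit Types (x y z : morphism I A).

Lemma hom_subgroupoid : subgroupoid C (hom C).
Proof.
split=> [b a //|a|c b a x w|b a w]; [exact: hom1|exact: homM|exact: homV].
Qed.

Lemma hom_sigma_to c j : hom C c (rho C j c) (sigma C c j).
Proof. by rewrite -{1}(rhoK C j c) -sigma_rho; exact: hom_sigma. Qed.

Lemma parabolic_hom J b a w : parabolic C J b a w -> hom C b a w.
Proof.
by move=> h; apply: h; [exact: hom_subgroupoid|move=> j c _; exact: hom_sigma_to].
Qed.

(** The morphisms that are the identity off [J] form a subgroupoid containing the generators, so
    minimality of the parabolic subgroupoid applies. *)
Lemma parabolic_off J b a w : parabolic C J b a w -> id_off (mem J) w.
Proof.
move=> h; suff [//] : hom C b a w /\ id_off (mem J) w.
apply: (h (fun b a => [set w | hom C b a w /\ id_off (mem J) w])); last first.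
  by move=> j c jJ; split; [exact: hom_sigma_to|exact: sigma_off].
split=> [b' a' v [] //|a'|c b' a' x v [hx ox] [hv ov]|b' a' v [hv ov]]; split.
- exact: hom1.
- exact: id_off1.
- exact: homM hx hv.
- exact: id_offM.
- exact: homV.
- by apply: id_offV => //; exact: hom_unit hv.
Qed.

Lemma parabolic_subgroupoid J : subgroupoid C (parabolic C J).
Proof.
split=> [b a w|a H [_ h1 _ _] //|c b a x w hx hw H HH HJ|b a w hw H HH HJ].
- exact: parabolic_hom.
- by have [_ _ hM _] := HH; apply: hM (hx H HH HJ) (hw H HH HJ).
- by have [_ _ _ hV] := HH; apply: hV (hw H HH HJ).
Qed.

Lemma parabolic_sigma J c j : j \in J -> parabolic C J c (rho C j c) (sigma C c j).
Proof. by move=> jJ H _; apply. Qed.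

Lemma parabolic_mono J J' b a w : J \subset J' -> parabolic C J b a w -> parabolic C J' b a w.
Proof.
move=> JJ h H HH HJ; apply: h => // j c jJ; apply: HJ.
exact: (fintype.subsetP JJ).
Qed.

Lemma coset_refl x J : left_coset C x J x.
Proof.
have [_ h1 _ _] := parabolic_subgroupoid J.
by exists 1%:M; [exact: h1|rewrite mulmx1].
Qed.

Lemma coset_hom a x y J : hom_to C a x -> left_coset C x J y -> hom_to C a y.
Proof.
by rewrite !hom_toE => hx [v /parabolic_hom hv ->]; exact: homM hv hx.
Qed.

Lemma coset_sub x y J : left_coset C x J y -> left_coset C y J `<=` left_coset C x J.
Proof.
have [_ _ hM _] := parabolic_subgroupoid J.
move=> [v hv yE] z [u hu zE]; exists (v *m u); first exact: hM hu hv.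
by rewrite zE yE mulmxA.
Qed.

Lemma coset_eq x y J : left_coset C x J y -> left_coset C y J = left_coset C x J.
Proof.
move=> xy; apply/seteqP; split; first exact: coset_sub.
apply: coset_sub; have [_ _ _ hV] := parabolic_subgroupoid J.
have [v hv yE] := xy; exists (invmx v); first exact: hV.
by rewrite yE mulmxK //; exact: hom_unit (parabolic_hom hv).
Qed.

(** For distinct indices, the neighbour of [x] across the wall [i] lies in the second coset but not
    in the first, whose elements keep the coordinate [i], while the reflection negates [alpha i]. *)
Lemma coset_index_inj a x i i' : hom_to C a x ->
  left_coset C x (~: [set i])%SET = left_coset C x (~: [set i'])%SET -> i = i'.
Proof.
rewrite hom_toE => hx e; apply/eqP/negPn/negP => ii'.
have : left_coset C x (~: [set i'])%SET (rho C i x.1, x.2 *m sigma C x.1 i).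
  exists (sigma C x.1 i) => //=.
  rewrite -sigma_rho -{2}(rhoK C i x.1); apply: parabolic_sigma.
  by rewrite !inE.
rewrite -e => -[v /parabolic_off ov /= /(congr1 (mulmx (invmx x.2)))].
rewrite !mulKmx ?(hom_unit hx) // => ev.
have := ov i; rewrite !inE eqxx -ev => /(_ isT (alpha i)).
by rewrite sigma_alpha_id entryN entry_alpha eqxx.
Qed.

(** Here [K] is the complement of the index set of the corresponding cell, so that larger faces have
    larger [K]. *)
Definition coset_face x (K : {set I}) : set (set (morphism I A)) :=
  [set X | exists2 i, i \in K & X = left_coset C x (~: [set i])%SET].

(** A common element [x] of the cosets in [F] represents each of them, and a maximal proper index
    set omits exactly one [i]. *)
Lemma coset_faceP a F : coxeter_complex C a F <->
  exists x (K : {set I}), [/\ hom_to C a x, (0 < #|K|)%N & F = coset_face x K].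
Proof.
split=> [[[X0 FX0] Fm [x Fx]]|[x [K [hx K0 ->]]]].
  have FE X : F X -> exists i, X = left_coset C x (~: [set i])%SET.
    move=> FX; have [y [J [hy cJ XE]]] := Fm _ FX.
    have : #|~: J|%SET == 1%N.
      by rewrite -(eqn_add2l #|J|) cardsC addn1 cJ.
    move=> /cards1P [i Ji]; exists i; rewrite XE -Ji finset.setCK.
    by symmetry; apply: coset_eq; rewrite -XE; exact: Fx.
  exists x, [set i | `[< F (left_coset C x (~: [set i])%SET) >]]%SET; split.
  - have [y [J [hy _ XE]]] := Fm _ FX0; apply: coset_hom hy (_ : left_coset C y J x).
    by rewrite -XE; exact: Fx.
  - have [i Xi] := FE _ FX0; apply/card_gt0P; exists i; rewrite inE.
    by apply/asboolP; rewrite -Xi.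
  - apply/seteqP; split=> X.
      move=> FX; have [i Xi] := FE _ FX; exists i => //; rewrite inE.
      by apply/asboolP; rewrite -Xi.
    by move=> [i + ->]; rewrite inE => /asboolP.
split.
- have /card_gt0P [i iK] := K0; exists (left_coset C x (~: [set i])%SET).
  by exists i.
- move=> X [i iK ->]; exists x, (~: [set i])%SET; split => //.
  by rewrite -(cardsC [set i]%SET) cards1.
- by exists x => X [i _ ->]; exact: coset_refl.
Qed.

End Parabolics.

(** * Cells *)

Section ScalarProduct.
Variables (R : realType) (I : finType) (dot : {dot 'cV[R]_#|I| for @idfun R}).
Implicit Types (l m : 'cV[R]_#|I|) (w v : 'M[int]_#|I|) (x : 'cV[int]_#|I|).

Definition pairing l x : R := dot l (embed R x).

Lemma pairingD l x y : pairing l (x + y) = pairing l x + pairing l y.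
Proof. by rewrite /pairing /embed map_mxD linearDr. Qed.

Lemma pairingZ l n x : pairing l (n *: x) = n%:~R * pairing l x.
Proof. by rewrite /pairing /embed map_mxZ linearZr_LR. Qed.

Lemma pairingN l x : pairing l (- x) = - pairing l x.
Proof. by rewrite -scaleN1r pairingZ mulN1r. Qed.

Lemma pairing_sum l (F : I -> 'cV[int]_#|I|) :
  pairing l (\sum_i F i) = \sum_i pairing l (F i).
Proof.
rewrite /pairing /embed (raddf_sum (map_mx intr)) /= linear_sumr.
by apply: eq_bigr.
Qed.

Lemma pairing_mul l w x : pairing l (w *m x) = \sum_i (entry x i)%:~R * pairing l (w *m alpha i).
Proof.
by rewrite mulmx_expand pairing_sum; apply: eq_bigr => i _; rewrite pairingZ.
Qed.

Lemma dot_expandl l m : dot l m = \sum_p l p 0 * dot (delta_mx p 0) m.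
Proof.
rewrite {1}[l]matrix_sum_delta linear_sumlz; apply: eq_bigr => p _.
by rewrite big_ord1 linearZl_LR.
Qed.

Lemma dot_expandr l m : dot l m = \sum_p m p 0 * dot l (delta_mx p 0).
Proof.
rewrite {1}[m]matrix_sum_delta linear_sumr; apply: eq_bigr => p _.
by rewrite big_ord1 linearZr_LR.
Qed.

(** The coefficients [f p] may depend on the point, so that the squared norm is covered as well as
    linear forms. *)
Lemma coord_comb_continuous n (f : 'I_n -> 'cV[R]_n -> R) :
  (forall p, continuous (f p)) -> continuous (fun l : 'cV[R]_n => \sum_p l p 0 * f p l).
Proof.
move=> hf; apply: continuous_big => [|p _ l]; first exact: add_continuous.
by apply: continuousM; [exact: coord_continuous|exact: hf].
Qed.

Lemma dot_continuousl m : continuous (fun l => dot l m).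
Proof.
rewrite (_ : (fun l => _) = fun l => \sum_p l p 0 * dot (delta_mx p 0) m).
  by apply: (@coord_comb_continuous _ (fun p _ => _)) => p l; exact: cst_continuous.
by apply/funext => l; exact: dot_expandl.
Qed.

Lemma dot_continuousr l : continuous (dot l).
Proof.
rewrite (_ : (dot l : _ -> _) = fun m => \sum_p m p 0 * dot l (delta_mx p 0)).
  by apply: (@coord_comb_continuous _ (fun p _ => _)) => p m; exact: cst_continuous.
by apply/funext => m; exact: dot_expandr.
Qed.

Lemma sqnorm_continuous : continuous (fun l => dot l l).
Proof.
rewrite (_ : (fun l => _) = fun l => \sum_p l p 0 * dot (delta_mx p 0) l).
  by apply: coord_comb_continuous => p; exact: dot_continuousr.
by apply/funext => l; exact: dot_expandl.
Qed.

(** The matrix [M] pairs the standard basis with the vectors [w *m alpha i]. A vector in its left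
    kernel is orthogonal to all of these, hence to every basis vector and to itself, contradicting
    positive definiteness. *)
Lemma dual_vector w (c : I -> R) : w \in unitmx ->
  exists l, forall i, pairing l (w *m alpha i) = c i.
Proof.
move=> uw.
pose M : 'M[R]_#|I| := \matrix_(p, q) pairing (delta_mx p 0) (w *m alpha (enum_val q)).
have ME l i : pairing l (w *m alpha i) = (l^T *m M) 0 (enum_rank i).
  rewrite /pairing dot_expandl mxE; apply: eq_bigr => p _.
  by rewrite !mxE enum_rankK.
have uM : M \in unitmx.
  rewrite unitmxE unitfE; apply/negP => /det0P [u u0 uM].
  have lM i : pairing u^T (w *m alpha i) = 0 by rewrite ME trmxK uM mxE.
  have u'0 : u^T != 0 by apply: contra_neq u0 => h; rewrite -[u]trmxK h trmx0.
  have := neq0_dnorm_gt0 (s := dot) _ u'0; rewrite dot_expandr big1 ?ltxx // => p _.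
  rewrite (_ : dot _ _ = 0) ?mulr0 //.
  have -> : delta_mx p 0 = embed R (alpha (enum_val p)) :> 'cV[R]_#|I|.
    by apply/matrixP => q r; rewrite !mxE enum_valK; case: (_ && _).
  rewrite -[X in embed R X](mulKVmx uw) -/(pairing _ _) pairing_mul.
  by rewrite big1 // => i _; rewrite lM mulr0.
exists ((\row_q c (enum_val q)) *m invmx M)^T => i.
by rewrite ME trmxK mulmxKV // mxE enum_rankK.
Qed.

Definition open_cell w (K : {set I}) : set 'cV[R]_#|I| :=
  root_cone dot w (~: K)%SET `&` unit_sphere dot.

(** The weak form of the inequalities of [open_cell]: a closed set, hence an upper bound for the
    closure of that cell. *)
Definition closed_cell w (K : {set I}) : set 'cV[R]_#|I| :=
  [set l | [/\ dot l l = 1, forall i, 0 <= pairing l (w *m alpha i)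
    & forall i, i \notin K -> pairing l (w *m alpha i) = 0]].

Lemma open_cellP w (K : {set I}) l : open_cell w K l <->
  [/\ dot l l = 1, forall i, i \in K -> 0 < pairing l (w *m alpha i)
    & forall i, i \notin K -> pairing l (w *m alpha i) = 0].
Proof.
split=> [[[h1 h2] h3]|[h3 h2 h1]].
  split=> // i iK; first by apply: h2; rewrite inE negbK.
  by apply: h1; rewrite inE.
by split=> //; split=> i; rewrite !inE ?negbK; [exact: h1|exact: h2].
Qed.

Lemma open_sub_closed w (K : {set I}) : open_cell w K `<=` closed_cell w K.
Proof.
move=> l /open_cellP [h1 h2 h3]; split=> // i.
by case: (boolP (i \in K)) => [/h2 /ltW|/h3 ->].
Qed.

Lemma normalize_open_cell w (K : {set I}) l : (0 < #|K|)%N ->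
    (forall i, i \in K -> 0 < pairing l (w *m alpha i)) ->
    (forall i, i \notin K -> pairing l (w *m alpha i) = 0) ->
  open_cell w K ((Num.sqrt (dot l l))^-1 *: l).
Proof.
move=> /card_gt0P [k kK] lp lz.
have l0 : l != 0.
  by apply/eqP => l0; have := lp _ kK; rewrite l0 /pairing linear0l ltxx.
have dl := neq0_dnorm_gt0 (s := dot) _ l0.
set s := Num.sqrt (dot l l); have s0 : 0 < s by rewrite sqrtr_gt0.
apply/open_cellP; split.
- rewrite linearZl_LR linearZr_LR /= mulrA -expr2 exprVn sqr_sqrtr ?(ltW dl) //.
  by rewrite mulVf ?gt_eqF.
- by move=> i iK; rewrite /pairing linearZl_LR /= mulr_gt0 ?invr_gt0 // lp.
- by move=> i iK; rewrite /pairing linearZl_LR /= -/(pairing _ _) lz // mulr0.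
Qed.

Lemma open_cell_nonempty w (K : {set I}) : w \in unitmx -> (0 < #|K|)%N ->
  open_cell w K !=set0.
Proof.
move=> uw K0; have [l hl] := dual_vector (fun i => (i \in K)%:R) uw.
eexists; apply: (@normalize_open_cell w K l K0) => i; rewrite hl.
  by move=> ->.
by move=> /negPf ->.
Qed.

Lemma closed_cell_closed w (K : {set I}) : closed (closed_cell w K).
Proof.
have -> : closed_cell w K = [set l | dot l l = 1] `&`
    (\bigcap_(i in setT) [set l | 0 <= pairing l (w *m alpha i)]) `&`
    (\bigcap_(i in [set i | i \notin K]) [set l | pairing l (w *m alpha i) = 0]).
  apply/seteqP; split=> l.
    by move=> [h1 h2 h3]; split; [split=> // i _; exact: h2|move=> i; exact: h3].
  by move=> [[h1 h2] h3]; split=> // i; exact: h2.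
have pc i : continuous (fun l => pairing l (w *m alpha i)) by exact: dot_continuousl.
apply: closedI; first apply: closedI.
- exact: ((continuous_closedP (fun l => dot l l)).1 sqnorm_continuous _ (@closed_eq _ 1)).
- by apply: closed_bigI => i _; exact: ((continuous_closedP _).1 (pc i) _ (@closed_ge _ 0)).
- by apply: closed_bigI => i _; exact: ((continuous_closedP _).1 (pc i) _ (@closed_eq _ 0)).
Qed.

Lemma closure_open_cell w (K : {set I}) : closure (open_cell w K) `<=` closed_cell w K.
Proof.
have := closure_subset (@open_sub_closed w K).
by rewrite -((closure_id _).1 (@closed_cell_closed w K)).
Qed.

(** A point [l] of the smaller cell is approached by [l + t *: m], with [m] in the larger cell and
    [t] decreasing to zero, after projection back to the unit sphere. *)
Lemma open_cell_in_closure w (K K' : {set I}) : w \in unitmx -> (0 < #|K|)%N ->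
  K \subset K' -> open_cell w K `<=` closure (open_cell w K').
Proof.
move=> uw K0 KK l lK; have [_ lp _] := open_sub_closed lK.
have [l1 _ lz] := (open_cellP _ _ _).1 lK.
have K'0 : (0 < #|K'|)%N := leq_trans K0 (subset_leq_card KK).
have [m /open_cellP [_ mp mz]] := open_cell_nonempty uw K'0.
pose q t := l + t *: m; pose g t := (Num.sqrt (dot (q t) (q t)))^-1 *: q t.
have gK' t : 0 < t -> open_cell w K' (g t).
  move=> t0; apply: normalize_open_cell => // i iK'.
    rewrite /pairing linearDl linearZl_LR /= ltr_wpDl ?lp //.
    by rewrite mulr_gt0 ?mp.
  rewrite /pairing linearDl linearZl_LR /= -!/(pairing _ _) mz // mulr0 addr0.
  by apply: lz; apply: contra iK'; exact: (fintype.subsetP KK).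
have cq : q t @[t --> 0^'+] --> l.
  rewrite -[X in _ --> X]addr0 -(scale0r m); apply: cvgD; first exact: cvg_cst.
  apply: cvgZr_tmp; apply: cvg_at_right_filter; exact: cvg_id.
have cn : Num.sqrt (dot (q t) (q t)) @[t --> 0^'+] --> (1 : R).
  rewrite -sqrtr1 -l1.
  apply: (cvg_comp q (fun l => Num.sqrt (dot l l)) cq).
  apply: (cvg_comp _ Num.sqrt (@sqnorm_continuous l)).
  exact: sqrt_continuous.
have cg : g t @[t --> 0^'+] --> l.
  rewrite -[X in _ --> X]scale1r -[1]invr1; apply: cvgZ cq.
  by apply: cvgV cn; exact: oner_neq0.
move=> B /cg gB; have {}gB : \forall t \near (0 : R)^'+, B (g t) by exact: gB.
have [t [gt t0]] := filter_ex (filterI gB (nbhs_right_gt (0 : R))).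
by exists (g t); split=> //; exact: gK'.
Qed.

End ScalarProduct.

(** * The correspondence between faces and cells *)

Section Isomorphism.
Variables (R : realType) (I A : finType) (C : cartan_scheme I A).
Variable dot : {dot 'cV[R]_#|I| for @idfun R}.
Hypothesis hC : finite_root_system C (real_roots C).
Implicit Types (a b c : A) (i j k : I) (w v : 'M[int]_#|I|) (l : 'cV[R]_#|I|).
Implicit Types (x y z : morphism I A) (J K : {set I}).

Let level l w i := pairing dot l (w *m alpha i).

(** If [y] descends to [y s_i] and the closed chambers of [x] and [x y] both
    contain [l], then [l] is orthogonal to [x y alpha_i]; as [y s_i] is already
    in [W_J], this forces [i \in J]. *)
Lemma closed_chamber_parabolic a x y l : hom_to C a x -> hom_to C x.1 y ->
    (forall i, 0 <= level l x.2 i) -> (forall i, 0 <= level l (x.2 *m y.2) i) ->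
  parabolic C [set i | level l x.2 i == 0] y.1 x.1 y.2.
Proof.
move=> hx hy px; set J := [set i | _]%SET.
have : star (descent C) y (x.1, 1%:M) by exact: descent_to_id.
have [_ P1 PM _] := parabolic_subgroupoid C J.
move e : (x.1, 1%:M) => z st; elim: st e hy => {y z} [y <- _ _|y y' z yy' _ ih e hy py].
  exact: P1.
have hy' := descent_hom hy yy'; case: yy' ih hy' => i ni -> ih hy'.
set u := y.2 *m sigma C y.1 i in ih hy' *.
have yE : y.2 = u *m sigma C (rho C i y.1) i.
  by rewrite sigma_rho /u -mulmxA sigmaK mulmx1.
have ui : u *m alpha i = - (y.2 *m alpha i) by rewrite /u -mulmxA sigma_alpha_id mulmxN.
have nu : nonneg (u *m alpha i) by rewrite ui.
(* The left side is nonnegative and the right side is minus a sum of nonnegative terms, so every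
   term vanishes. *)
have pyE : level l (x.2 *m y.2) i = - \sum_k (entry (u *m alpha i) k)%:~R * level l x.2 k.
  by rewrite /level -mulmxA -[y.2 *m _]opprK -ui mulmxN pairingN pairing_mul.
have t0 k : 0 <= (entry (u *m alpha i) k)%:~R * level l x.2 k.
  by rewrite mulr_ge0 ?ler0z ?px //; exact: (nonnegP _ nu).
have s0 : \sum_k (entry (u *m alpha i) k)%:~R * level l x.2 k = 0.
  apply/eqP; rewrite eq_le sumr_ge0 // andbT -oppr_ge0 -pyE; exact: py.
have yi0 : level l (x.2 *m y.2) i = 0 by rewrite pyE s0 oppr0.
have uJ : parabolic C J (rho C i y.1) x.1 u.
  (* The reflection changes the level of [k] by a multiple of the level of [i], which is zero; so
     [l] also lies in the closed chamber of [x] times [u]. *)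
  apply: ih => // k.
  rewrite /u mulmxA /level -[_ *m sigma _ _ _ *m _]mulmxA sigma_alpha mulmxBr -scalemxAr.
  rewrite pairingD pairingN pairingZ -!/(level _ _ _) yi0 mulr0 subr0; exact: py.
have iJ : i \in J.
  apply/negPn/negP => iJ; move: (iJ); rewrite inE => /negP; apply.
  (* If [i] were outside [J], then [u] would keep the coefficient 1 of [alpha i], and the vanishing
     term would be the level of [i] itself. *)
  have := psumr_eq0P (fun k _ => t0 k) s0 (i := i) isT.
  by rewrite (parabolic_off uJ) // entry_alpha eqxx mul1r => ->.
rewrite yE; apply: PM _ uJ.
by rewrite sigma_rho; exact: parabolic_sigma.
Qed.

Lemma closed_chambers_coset a x y l : hom_to C a x -> hom_to C a y ->
    (forall i, 0 <= level l x.2 i) -> (forall i, 0 <= level l y.2 i) ->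
  left_coset C x [set i | level l x.2 i == 0] y.
Proof.
move=> hx hy px py.
have ux : x.2 \in unitmx by rewrite hom_toE in hx; exact: hom_unit hx.
have xyE : x.2 *m (invmx x.2 *m y.2) = y.2 by rewrite mulKVmx.
exists (invmx x.2 *m y.2) => //.
apply: (@closed_chamber_parabolic a x (y.1, invmx x.2 *m y.2) l hx) => //=.
  by move: hx hy; rewrite !hom_toE => hx hy; apply: homM hy (homV hx).
by rewrite xyE.
Qed.

(** The matrix [v] alters vectors only by combinations of the [alpha k] with [k] outside [K], and
    [l] is orthogonal to the images of these under [w]. *)
Lemma id_off_open_cell w v K : id_off (mem (~: K)%SET) v ->
  open_cell dot w K `<=` open_cell dot (w *m v) K.
Proof.
move=> ov l /open_cellP [l1 lp lz].
have e i : level l (w *m v) i = if i \in K then level l w i else 0.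
  rewrite /level -mulmxA pairing_mul.
  have c0 k : k \in K -> entry (v *m alpha i) k = (k == i)%:R.
    by move=> kK; rewrite ov ?entry_alpha // !inE negbK.
  case: ifPn => iK.
    rewrite (bigD1 i) //= c0 // eqxx mul1r big1 ?addr0 // => k ki.
    have [kK|kK] := boolP (k \in K); last by rewrite lz ?mulr0.
    by rewrite c0 // (negPf ki) mul0r.
  rewrite big1 // => k _; have [kK|kK] := boolP (k \in K); last by rewrite lz ?mulr0.
  by rewrite c0 //; case: eqP kK iK => [->|] ; rewrite ?mul0r // => ->.
apply/open_cellP; split=> // i iK; rewrite -/(level _ _ _) e.
  by rewrite iK; exact: lp.
by rewrite (negPf iK).
Qed.

Lemma coset_face_index_sub a x y K K' : hom_to C a x ->
  coset_face C x K `<=` coset_face C y K' ->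
  {in K, forall i, left_coset C x (~: [set i])%SET y} -> K \subset K'.
Proof.
move=> hx sub hy; apply/fintype.subsetP => i iK.
have [|i' iK' e] := sub (left_coset C x (~: [set i])%SET); first by exists i.
have e' := coset_eq (hy _ iK).
have hy' : hom_to C a y by exact: coset_hom hx (hy _ iK).
by rewrite -e' in e; rewrite (coset_index_inj hy' e).
Qed.

Lemma coset_face_mem a x y K K' : hom_to C a x ->
  coset_face C x K `<=` coset_face C y K' -> {in K, forall i, left_coset C x (~: [set i])%SET y}.
Proof.
move=> hx sub i iK.
have [|i' _ ->] := sub (left_coset C x (~: [set i])%SET); first by exists i.
exact: coset_refl.
Qed.

(** The quotient of [y] by [x] lies in the parabolic omitting [i] for each [i] in [K], so it
    preserves all coordinates in [K]; this suffices for [id_off_open_cell] in both directions. *)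
Lemma coset_face_open_cell a x y K : hom_to C a x ->
  {in K, forall i, left_coset C x (~: [set i])%SET y} -> hom_to C a y ->
  open_cell dot x.2 K = open_cell dot y.2 K.
Proof.
rewrite !hom_toE => hx xy hy.
have ux := hom_unit hx; have uy := hom_unit hy.
set v := invmx x.2 *m y.2.
have uv : v \in unitmx by rewrite unitmx_mul unitmx_inv ux.
have yE : y.2 = x.2 *m v by rewrite mulKVmx.
have ov : id_off (mem (~: K)%SET) v.
  move=> k; rewrite !inE negbK => kK; have [u /parabolic_off ou uE] := xy _ kK.
  by rewrite /v uE mulKmx // => z; apply: ou; rewrite !inE negbK eqxx.
apply/seteqP; split; first by rewrite yE; exact: id_off_open_cell.
by rewrite -[x.2](mulmxK uv) -yE; apply: id_off_open_cell; exact: id_offV.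
Qed.

(** Makes the cell of a face independent of its presentation: equal faces have the same [K], and
    each base point lies in all vertices of the other. *)
Lemma coset_face_inj a x y K K' : hom_to C a x -> hom_to C a y ->
  coset_face C x K = coset_face C y K' -> open_cell dot x.2 K = open_cell dot y.2 K'.
Proof.
move=> hx hy e.
have sxy : coset_face C x K `<=` coset_face C y K' by rewrite e.
have syx : coset_face C y K' `<=` coset_face C x K by rewrite e.
have xy := coset_face_mem hx sxy; have yx := coset_face_mem hy syx.
have -> : K' = K.
  apply/eqP; rewrite finset.eqEsubset.
  by rewrite (coset_face_index_sub hy syx yx) (coset_face_index_sub hx sxy xy).
exact: coset_face_open_cell hx xy hy.
Qed.

(** A point [l] of the first cell lies in both closed chambers, so [y] is in the coset of [x] for
    the walls through [l], which form the complement of [K]. Hence [y] lies in every vertex of the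
    first face. *)
Lemma open_cell_coset_face a x y K K' : hom_to C a x -> hom_to C a y -> (0 < #|K|)%N ->
  open_cell dot x.2 K `<=` closure (open_cell dot y.2 K') ->
  coset_face C x K `<=` coset_face C y K'.
Proof.
move=> hx hy K0 sub.
have ux : x.2 \in unitmx by move: hx; rewrite hom_toE => /hom_unit.
have [l lx] := open_cell_nonempty dot ux K0.
have [_ ly ly0] := closure_open_cell (sub _ lx).
have [_ px _] := open_sub_closed lx; have [_ lp lz] := (open_cellP _ _ _ _).1 lx.
have := closed_chambers_coset hx hy px ly; set J := (X in left_coset _ _ X) => xy.
have JE k : (k \in J) = (k \notin K).
  rewrite inE; have [kK|kK] := boolP (k \in K); last by rewrite /level lz ?eqxx.
  by rewrite gt_eqF //; exact: lp.
have JS i : i \in K -> J \subset (~: [set i])%SET.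
  move=> iK; apply/fintype.subsetP => k; rewrite JE !inE.
  by apply: contraNneq => ->.
have xyi : {in K, forall i, left_coset C x (~: [set i])%SET y}.
  move=> i iK; have [v hv yE] := xy; exists v => //.
  exact: parabolic_mono (JS i iK) hv.
have KK : K \subset K'.
  apply/fintype.subsetP => i iK; apply/negPn/negP => /ly0 yi.
  have [v /parabolic_off ov yE] := xy.
  (* Passing from [x] to [y] adds only roots orthogonal to [l], so the level of [i] stays positive,
     whereas it would vanish for [i] outside [K']. *)
  have : level l y.2 i = level l x.2 i.
    rewrite /level yE -mulmxA pairing_mul (bigD1 i) //= ov ?JE ?iK //.
    rewrite entry_alpha eqxx mul1r big1 ?addr0 // => k ki.
    have [kK|kK] := boolP (k \in K); last by rewrite lz // mulr0.
    by rewrite ov ?JE ?kK // entry_alpha (negPf ki) mul0r.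
  by move=> e; have := lp _ iK; rewrite -/(level _ _ _) -e /level yi ltxx.
move=> X [i iK ->]; exists i; first exact: (fintype.subsetP KK).
by symmetry; apply: coset_eq; exact: xyi.
Qed.

Lemma coset_face_closure a x y K K' : hom_to C a x -> hom_to C a y -> (0 < #|K|)%N ->
  coset_face C x K `<=` coset_face C y K' ->
  closure (open_cell dot x.2 K) `<=` closure (open_cell dot y.2 K').
Proof.
move=> hx hy K0 sub; have xy := coset_face_mem hx sub.
have KK := coset_face_index_sub hx sub xy.
have uy : y.2 \in unitmx by move: hy; rewrite hom_toE => /hom_unit.
rewrite (coset_face_open_cell hx xy hy).
have := closure_subset (open_cell_in_closure (dot := dot) uy K0 KK).
by rewrite -((closure_id _).1 (@closed_closure _ _)).
Qed.

(** The union over all presentations of [F], which all give the same cell. *)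
Definition face_cell a (F : set (set (morphism I A))) : set 'cV[R]_#|I| :=
  [set l | exists x K, [/\ hom_to C a x, F = coset_face C x K & open_cell dot x.2 K l]].

Lemma face_cellE a x K : hom_to C a x ->
  face_cell a (coset_face C x K) = open_cell dot x.2 K.
Proof.
move=> hx; apply/seteqP; split=> l; last by exists x, K.
by move=> [y [K' [hy e h]]]; rewrite (coset_face_inj hx hy e).
Qed.

Lemma cell_complexP a D : cell_complex C dot a D <->
  exists x K, [/\ hom_to C a x, (0 < #|K|)%N & D = open_cell dot x.2 K].
Proof.
have pC K : ((~: K)%SET \proper [set: I]%SET) = (0 < #|K|)%N.
  by rewrite properT card_gt0 -(inj_eq (@finset.setC_inj I)) finset.setCK finset.setCT.
split=> [[x [J [hx JI ->]]]|[x [K [hx K0 ->]]]].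
  by exists x, (~: J)%SET; split=> //; rewrite -?pC /open_cell finset.setCK.
by exists x, (~: K)%SET; split=> //; rewrite pC.
Qed.

End Isomorphism.

(** * The isomorphism of the two complexes *)

Unset Implicit Arguments.
Set Strict Implicit.

Theorem corollary4p6 (R : realType) (I A : finType) (C : cartan_scheme I A)
    (hC : finite_root_system C (real_roots C)) (a : A)
    (dot : {dot 'cV[R]_#|I| for @idfun R}) :
  face_isomorphic
    (coxeter_complex C a) (fun F G => F `<=` G)
    (cell_complex C dot a) (fun D E => closure D `<=` closure E).
Proof.
have mono F G : coxeter_complex C a F -> coxeter_complex C a G ->
    F `<=` G <-> closure (face_cell C dot a F) `<=` closure (face_cell C dot a G).
  move=> /coset_faceP [x [K [hx K0 ->]]] /coset_faceP [y [K' [hy K'0 ->]]].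
  rewrite !face_cellE //; split; first exact: (coset_face_closure hx hy K0).
  by move=> s; apply: (open_cell_coset_face hC hx hy K0) => l /subset_closure /s.
exists (face_cell C dot a) => //; split.
- move=> F /coset_faceP [x [K [hx K0 ->]]]; apply/cell_complexP; exists x, K.
  by rewrite face_cellE.
(* Injectivity follows from reflection of the order, since equal cells have equal closures. *)
- move=> F G; rewrite !inE => hF hG e.
  by apply/seteqP; split; apply/mono; rewrite ?e.
- move=> D /cell_complexP [x [K [hx K0 ->]]]; exists (coset_face C x K).
    by apply/coset_faceP; exists x, K.
  exact: face_cellE.
Qed.
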